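(* Let $d_1\in\mathbb{N}\setminus\{0,1\}$ and $k\in\mathbb{N}$, $k\ge 1$, and put $d=2d_1$, $s=d-1$, $N=2d_1k+d_1$. Let $F=F_1+\cdots+F_s+F_d$ and $G=G_1+\cdots+G_N$ be elements of $\mathbb{C}[x_1,\ldots,x_n]$, where $F_i$ and $G_j$ are homogeneous polynomials of degree $i$ and $j$, respectively. Assume that $\deg[F,G]<d+N-2k-2$, and that $F_d=h^d$ and $G_N=a_Nh^N$ for some homogeneous polynomial $h$ of degree one and some $a_N\in\mathbb{C}\setminus\{0\}$. Then there are a homogeneous polynomial $\tilde F_{d_1-1}$ of degree $d_1-1$ with $F_s=h^{d_1}\tilde F_{d_1-1}$ and a homogeneous polynomial $\hat F_{s-2}$ of degree $s-2$ such that $$F_{s-1}=\tfrac14\left(\tilde F_{d_1-1}^2+h\hat F_{s-2}\right).$$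
   Context: $\mathbb{N}=\{0,1,2,\ldots\}$. For $f,g\in\mathbb{C}[x_1,\ldots,x_n]$ the Poisson bracket is $[f,g]=\sum_{1\le i<j\le n}\left(\frac{\partial f}{\partial x_i}\frac{\partial g}{\partial x_j}-\frac{\partial f}{\partial x_j}\frac{\partial g}{\partial x_i}\right)[x_i,x_j]$, where $[x_i,x_j]=-[x_j,x_i]$ are formal symbols (linearly independent for $i<j$), and $\deg[f,g]=2+\max_{1\le i<j\le n}\deg\left(\frac{\partial f}{\partial x_i}\frac{\partial g}{\partial x_j}-\frac{\partial f}{\partial x_j}\frac{\partial g}{\partial x_i}\right)$, with $\deg 0=-\infty$. The zero polynomial counts as homogeneous of every degree.
   Formalization: The linear form h is assumed to be nonzero; for h = 0 (allowed by the convention that 0 is homogeneous of every degree) the claim fails, e.g. G = 0 and F = x_1^s. *)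

(* Defs.v *)
From HB Require Import structures.
From mathcomp Require Import all_boot all_order all_algebra.
From mathcomp Require Import complex mpoly.
From mathcomp Require Import constructive_ereal reals.

Set Implicit Arguments.
Unset Strict Implicit.
Unset Printing Implicit Defensive.

Import Order.TTheory GRing.Theory Num.Theory.
Local Open Scope ring_scope.

(* Total degree with values in the extended integers, so that [tdeg 0] is
   -oo; [msize p] is one plus the degree of [p], and is 0 for [p = 0]. *)
Definition tdeg (R : nzRingType) (n : nat) (p : {mpoly R[n]}) : \bar int :=
  if p == 0 then -oo%E else ((msize p).-1)%:Z%:E.

(* The formal symbols [x_i, x_j] with i < j are linearly independent, so a
   bracket is given by its coefficients at these symbols, stored above the
   diagonal of a matrix; all the other entries are 0. *)
Definition pbracket (R : nzRingType) (n : nat) (f g : {mpoly R[n]}) :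
    'M[{mpoly R[n]}]_n :=
  \matrix_(i, j)
    if (i < j)%N then f^`M(i) * g^`M(j) - f^`M(j) * g^`M(i) else 0.

(* Each symbol [x_i, x_j] contributes 2 to the degree; the maximum over the
   empty set (for n < 2), like the degree of the zero bracket, is -oo. *)
Definition bdeg (R : nzRingType) (n : nat) (w : 'M[{mpoly R[n]}]_n) : \bar int :=
  (2%:E + \big[maxe/-oo]_(ij : 'I_n * 'I_n | (ij.1 < ij.2)%N)
            tdeg (w ij.1 ij.2))%E.

(* Main.v *)
(* Put f_i = F_(d-i) and g_j = G_(N-j). The bracket condition says that the
   components sum_(i+j=m) [f_i, g_j] vanish for m <= 2k+2. Contracting with the
   Euler field turns this into
     sum_(i+j=m) (N-j) D(f_i) g_j - (d-i) f_i D(g_j) = 0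
   for any derivation D with constant coefficients; take D with D h = 1. Let
   d1 <= p <= d with h^(d-p) | f_1 and write f_i = h^(d-pi) phi_i (where d1 <= p
   covers i >= 2). Induction on j gives g_j = h^(N-pj) gam_j, and reduction modulo
   h leaves (p-1) sum_(i+j=m) (d j - N i) phi_i gam_j = 0. Hence, up to a constant
   and modulo h, gam is the power k + 1/2 of 1 + u T + v T^2, where v = 0 if p > d1.
   Its coefficient at T^(2k+2) is a nonzero multiple of (4v - u^2)^(k+1), while
   gam_(2k+2) = 0 modulo h since p(2k+2) > N. So 4v = u^2; for p > d1 this gives
   u = 0 and p can be lowered by one, and p = d1 is the claim. *)
Require Import Defs.
From HB Require Import structures.
From mathcomp Require Import all_boot all_order all_algebra.
From mathcomp Require Import complex mpoly.
From mathcomp Require Import constructive_ereal reals.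

From mathcomp Require Import ring zify.

Set Implicit Arguments.
Unset Strict Implicit.
Unset Printing Implicit Defensive.

Import Order.TTheory GRing.Theory Num.Theory.
Local Open Scope ring_scope.

(** * Half-integral powers of a quadratic trinomial, by coefficients *)

Definition shift (A : nmodType) (c : nat -> A) (m : nat) : A :=
  if m is m'.+1 then c m' else 0.

(* The coefficient of T^m in T (2 P c' - (2 K - 1) P' c), where P = 1 + u T + v T^2
   and c is read as a power series: it vanishes for all m iff c is a constant
   multiple of P^(K - 1/2). *)
Definition euler_defect (A : pzRingType) (K : nat) (u v : A) (c : nat -> A) (m : nat) : A :=
  2 * m%:R * c m - (2 * K%:R + 1 - 2 * m%:R) * u * shift c m
  - 2 * (2 * K%:R + 1 - m%:R) * v * shift (shift c) m.

(** Coefficients of the power series c / P, where P = 1 + u T + v T^2. *)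
Fixpoint div_trinomial (A : pzRingType) (u v : A) (c : nat -> A) (m : nat) : A :=
  if m is m'.+1 then
    c m - u * div_trinomial u v c m'
    - v * (if m' is m''.+1 then div_trinomial u v c m'' else 0)
  else c 0%N.

(** If c = P e, then 2 P c' - (2 K + 1) P' c = P (2 P e' - (2 K - 1) P' e). *)
Lemma euler_defect_div (A : comNzRingType) (K : nat) (u v : A) (c : nat -> A) m :
  let e := div_trinomial u v c in
  euler_defect K.+1 u v c m = euler_defect K u v e m
    + u * shift (euler_defect K u v e) m
    + v * shift (shift (euler_defect K u v e)) m.
Proof.
move=> e; rewrite /euler_defect.
case: m => [|[|n]]; rewrite /= -/e.
- by rewrite /e /=; ring.
- by rewrite /e /=; ring.
have -> : c n.+2 = e n.+2 + u * e n.+1 + v * e n by rewrite /e /=; ring.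
have -> : c n.+1 = e n.+1 + u * e n + v * shift e n.
  by rewrite /e; case: n => [|n] /=; ring.
have -> : c n = e n + u * shift e n + v * shift (shift e) n.
  by rewrite /e; case: n => [|[|n]] /=; ring.
ring.
Qed.

(* Dividing by P lowers K, and the recurrence shows that the coefficient of index
   2 K of P^(K - 1/2) is a rational multiple of (4 v - u^2) times the coefficient
   of index 2 (K - 1) of P^(K - 3/2). *)
Lemma euler_defect_eq0 (A : idomainType) (K : nat) (u v : A) (c : nat -> A) :
  [pchar A] =i pred0 -> c 0%N != 0 -> c (2 * K)%N = 0 ->
  (forall m, (m <= 2 * K)%N -> euler_defect K u v c m = 0) -> u ^+ 2 = 4 * v.
Proof.
move=> /pcharf0P ch; elim: K c => [|K IH] c; first by move=> /negP c0 /eqP.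
move=> c0 c2K rec; set e := div_trinomial u v c.
(* P has constant term 1, so vanishing passes from the defect of c to that of e, index by index. *)
have rec' m : (m <= 2 * K.+1)%N -> euler_defect K u v e m = 0.
  elim/ltn_ind: m => m IHm le_m; have := rec _ le_m; rewrite euler_defect_div -/e.
  case: m IHm le_m => [|[|m]] /= IHm le_m.
  - by move=> <-; ring.
  - by rewrite (IHm 0%N) => [|//|//] <-; ring.
  - by rewrite (IHm m.+1) ?(IHm m) ?mulr0 ?addr0 //; lia.
have e2 : c (2 * K).+2 = e (2 * K).+2 + u * e (2 * K).+1 + v * e (2 * K)%N.
  by rewrite /e /=; ring.
rewrite mulnS add2n e2 in c2K.
have := rec' (2 * K).+2 ltac:(lia).
have := rec' (2 * K).+1 ltac:(lia).
rewrite /euler_defect /=; set x := e _.+2 in c2K *; set y := e _.+1 in c2K *.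
set z := e (2 * K)%N in c2K * => r1 r2.
have nz n : n.+1%:R != 0 :> A by rewrite ch.
(* At index 2 K + 1 the coefficient of v in the recurrence is 0. *)
have /eqP : (2 * K).+1%:R * (2 * y + u * z) = 0 by rewrite -r1; ring.
rewrite mulf_eq0 (negPf (nz _)) /= => /eqP E1.
(* Eliminates x and y using c_(2K+2) = 0, the recurrence of index 2 K + 2 and 2 y + u z = 0. *)
have /eqP : (2 * K).+1%:R * ((u ^+ 2 - 4 * v) * z) = 0.
  transitivity (- 2 * (4 * (K%:R + 1) * (x + u * y + v * z) 
     - (2 * (2 * K).+2%:R * x - (2 * K%:R + 1 - 2 * (2 * K).+2%:R) * u * y -
     2 * (2 * K%:R + 1 - (2 * K).+2%:R) * v * z))
    + (2 * K).+1%:R * u * (2 * y + u * z)); first by ring.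
  by rewrite c2K r2 E1; ring.
rewrite !mulf_eq0 (negPf (nz _)) /= subr_eq0 => /orP[/eqP //|/eqP e2K].
apply: (IH e) => // m le_m; apply: rec'; lia.
Qed.

(** * Powers of h and leading parts in a domain with a reduction modulo h *)

Section LeadingParts.

Variables (A B : idomainType) (sigma : {rmorphism A -> B}) (D : A -> A) (h : A).
Hypothesis charB : [pchar B] =i pred0.
Hypothesis DM : forall x y, D (x * y) = D x * y + x * D y.
Hypothesis Dh : D h = 1.
Hypothesis h_neq0 : h != 0.
Hypothesis sigma_h : sigma h = 0.
Hypothesis ker_sigma : forall x, sigma x = 0 -> exists y, x = h * y.

Lemma deriv1 : D 1 = 0.
Proof. by have := DM 1 1; rewrite !mulr1 !mul1r -[LHS]addr0 => /addrI. Qed.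

Lemma mul_derivX n x : h * D (h ^+ n * x) = h ^+ n * (n%:R * x + h * D x).
Proof.
suff DX : h * D (h ^+ n) = n%:R * h ^+ n by rewrite DM mulrDr (mulrA h (D _) x) DX; ring.
elim: n => [|n IH]; first by rewrite expr0 deriv1 mulr0 mul0r.
by rewrite exprS DM Dh mulrDr (mulrCA h h) IH -natr1; ring.
Qed.

(** Formally x = h^(n - P) y, and this is the product rule; multiplying out avoids a negative
    exponent n - P. *)
Lemma mul_deriv_rescaled P n x y :
  h ^+ P * x = h ^+ n * y ->
  h ^+ P.+1 * D x = h ^+ n * ((n%:R - P%:R) * y + h * D y).
Proof.
move=> e; have := mul_derivX P x; rewrite e mul_derivX => e'.
apply: (addrI (P%:R * (h ^+ P * x))); rewrite [in RHS]e exprS.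
by transitivity (h ^+ P * (P%:R * x + h * D x)); last rewrite -e'; ring.
Qed.

(* If x = h^e z with e < q, the left-hand side is h^e (c (r - e) z - c h D z), so h
   divides z because c (r - e) <> 0. *)
Lemma dvdX_of_euler c r q x y : (0 < c)%N -> (q <= r)%N ->
  c%:R * (r%:R * x - h * D x) = h ^+ q * y -> exists z, x = h ^+ q * z.
Proof.
move=> c0; elim: q y => [|q IH] y le_qr e; first by exists x; rewrite mul1r.
have [|z xE] := IH (h * y) (ltnW le_qr); first by rewrite e exprSr mulrA.
move: e; rewrite xE mul_derivX => e.
have : c%:R * ((r - q)%:R * z - h * D z) = h * y.
  apply: (mulfI (expf_neq0 q h_neq0)); rewrite [in RHS]mulrA -exprSr -e natrB 1?ltnW //.
  by ring.
move/(congr1 sigma); rewrite !(rmorphM, rmorphB, rmorph_nat) /= sigma_h !mul0r subr0.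
move/eqP; rewrite !mulf_eq0 !(proj1 (pcharf0P B) charB) subn_eq0 leqNgt le_qr.
rewrite eqn0Ngt c0 /= => /eqP /ker_sigma [t ->].
by exists t; rewrite exprSr mulrA.
Qed.

Section Rescaling.

Variables (d N M p : nat) (a : A) (f g phi : nat -> A).
Hypotheses (d_gt0 : (0 < d)%N) (p_gt0 : (0 < p)%N).
Hypotheses (f0 : f 0%N = h ^+ d) (g0 : g 0%N = h ^+ N * a).
Hypothesis bracket0 : forall m, (m <= M)%N ->
  \sum_(i < m.+1) ((N%:R - (m - i)%:R) * D (f i) * g (m - i)%N
                   - (d%:R - i%:R) * f i * D (g (m - i)%N)) = 0.
Hypothesis phiE : forall i, (i <= M)%N -> h ^+ (p * i) * f i = h ^+ d * phi i.

(** The (i, j) summand of [bracket0] for f_i = h^(d - p i) phi_i and g_j = h^(N - p j) gam_j, with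
    h^(d + N - p (i + j) - 1) divided out. *)
Definition rescaled_term (gam : nat -> A) (i j : nat) : A :=
  (N%:R - j%:R) * ((d%:R - (p * i)%:R) * phi i + h * D (phi i)) * gam j
  - (d%:R - i%:R) * phi i * ((N%:R - (p * j)%:R) * gam j + h * D (gam j)).

Lemma rescaled_termE gam i j : (i <= M)%N ->
  h ^+ (p * j) * g j = h ^+ N * gam j ->
  h ^+ (p * (i + j)).+1 * ((N%:R - j%:R) * D (f i) * g j
                   - (d%:R - i%:R) * f i * D (g j))
  = h ^+ (d + N) * rescaled_term gam i j.
Proof.
move=> le_iM gE; have fE := phiE le_iM.
transitivity ((N%:R - j%:R) * (h ^+ (p * i).+1 * D (f i)) * (h ^+ (p * j) * g j)
  - (d%:R - i%:R) * (h ^+ (p * i) * f i) * (h ^+ (p * j).+1 * D (g j))).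
  by rewrite mulnDr !exprS !exprD; ring.
by rewrite (mul_deriv_rescaled fE) (mul_deriv_rescaled gE) fE gE exprD /rescaled_term; ring.
Qed.

(** In the bracket identity of index m + 1 only the summand i = 0 contains g_(m+1). As f_0 = h^d, it
    equals h^(d - 1) d ((N - m - 1) g_(m+1) - h D(g_(m+1))); the other summands are known by
    induction. *)
Lemma rescaled_exists m : (m <= M)%N ->
  exists2 gam : nat -> A, gam 0%N = a &
    forall j, (j <= m)%N -> h ^+ (p * j) * g j = h ^+ N * gam j.
Proof.
elim: m => [_|m IH lt_mM].
  by exists (fun=> a) => // j; rewrite leqn0 => /eqP ->; rewrite muln0 mul1r.
have [gam gam0 gamE] := IH (ltnW lt_mM).
suff [z zE] : exists z, h ^+ (p * m.+1) * g m.+1 = h ^+ N * z.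
  exists (fun j => if j == m.+1 then z else gam j) => // j.
  by case: eqP => [-> //|/eqP ne le_j]; apply: gamE; lia.
have [le_N|lt_N] := leqP N (p * m.+1).
  by exists (h ^+ (p * m.+1 - N) * g m.+1); rewrite mulrA -exprD subnKC.
have le_mN : (m.+1 <= N)%N by apply: leq_trans (ltnW lt_N); rewrite leq_pmull.
suff [y yE] : exists y, d%:R * ((N - m.+1)%:R * g m.+1 - h * D (g m.+1))
    = h ^+ (N - p * m.+1) * y.
  have [|z zE] := dvdX_of_euler d_gt0 _ yE; first by rewrite leq_sub2l // leq_pmull.
  by exists z; rewrite {1}zE mulrA -exprD subnKC // ltnW.
exists (- \sum_(i < m.+1) rescaled_term gam i.+1 (m - i)).
have := congr1 ( *%R (h ^+ (p * m.+1).+1)) (bracket0 lt_mM).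
rewrite mulr0 big_ord_recl mulrDr mulr_sumr /=.
under eq_bigr => i _.
  have -> : bump 0 i = i.+1 by [].
  have -> : (p * m.+1 = p * (i.+1 + (m - i)))%N by congr (p * _)%N; have := ltn_ord i; lia.
  rewrite subSS (@rescaled_termE gam); [|have := ltn_ord i; lia|by apply: gamE; rewrite leq_subr].
  over.
rewrite -mulr_sumr subn0 f0; set S := \sum_i _ => e.
apply: (mulfI (expf_neq0 (d + p * m.+1) h_neq0)).
rewrite [in RHS]mulrA -exprD -addnA subnKC 1?ltnW // mulrN.
apply/eqP; rewrite -addr_eq0 -[X in _ == X]e; apply/eqP; congr (_ + _).
have := mul_derivX d 1; rewrite !mulr1 deriv1 mulr0 addr0 => hD; rewrite natrB // exprS exprD.
transitivity (h ^+ (p * m.+1) * ((N%:R - m.+1%:R) * (h * D (h ^+ d)) * g m.+1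
  - d%:R * h ^+ d * (h * D (g m.+1)))); last by ring.
by rewrite hD; ring.
Qed.

(** Modulo h the terms with h D disappear, and (N - j)(d - p i) - (d - i)(N - p j) = (p - 1)(d j - N
    i). *)
Lemma leading_bracket :
  exists gam : nat -> A,
    [/\ gam 0%N = a, forall j, (j <= M)%N -> h ^+ (p * j) * g j = h ^+ N * gam j &
     forall m, (m <= M)%N -> (p%:R - 1) *
       \sum_(i < m.+1) (d%:R * (m - i)%:R - N%:R * i%:R)
         * sigma (phi i) * sigma (gam (m - i)%N) = 0].
Proof.
have [gam gam0 gamE] := rescaled_exists (leqnn M); exists gam; split=> // m le_mM.
have := congr1 ( *%R (h ^+ (p * m).+1)) (bracket0 le_mM).
rewrite mulr0 mulr_sumr.
under eq_bigr => i _.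
  have e : (p * m = p * (i + (m - i)))%N by congr (p * _)%N; have := ltn_ord i; lia.
  rewrite e (@rescaled_termE gam); [|have := ltn_ord i; lia|by apply: gamE; lia].
  over.
rewrite -mulr_sumr => /eqP; rewrite mulf_eq0 expf_eq0 (negPf h_neq0) andbF /=.
move=> /eqP /(congr1 sigma); rewrite rmorph_sum rmorph0 => e0; rewrite -[RHS]e0.
rewrite mulr_sumr; apply: eq_bigr => i _; rewrite /rescaled_term.
rewrite !(rmorphM, rmorphB, rmorphD, rmorph_nat) /= sigma_h.
by ring.
Qed.

End Rescaling.

Lemma dvd_cancelX m n x y : (m < n)%N ->
  h ^+ n * x = h ^+ m * y -> sigma y = 0.
Proof.
move=> lt_mn; rewrite -(subnKC (ltnW lt_mn)) exprD -mulrA.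
move/(mulfI (expf_neq0 m h_neq0)) <-.
by rewrite rmorphM rmorphXn /= sigma_h expr0n subn_eq0 leqNgt lt_mn mul0r.
Qed.

Section Descent.

Variables (d1 k : nat) (a : A) (f g : nat -> A).
Hypotheses (d1_gt1 : (1 < d1)%N) (a_neq0 : sigma a != 0).
Hypotheses (f0 : f 0%N = h ^+ (2 * d1)) (g0 : g 0%N = h ^+ (d1 * (2 * k).+1) * a).
Hypothesis bracket0 : forall m, (m <= 2 * k.+1)%N ->
  \sum_(i < m.+1) (((d1 * (2 * k).+1)%:R - (m - i)%:R) * D (f i) * g (m - i)%N
                   - ((2 * d1)%:R - i%:R) * f i * D (g (m - i)%N)) = 0.

(* For p > d1 only u = sigma y survives among the leading parts of f, and the
   conclusion says that h divides y. *)
Lemma sqr_leading_part p y : (d1 <= p)%N -> h ^+ p * f 1%N = h ^+ (2 * d1) * y ->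
  sigma y ^+ 2 = 4 * (if p == d1 then sigma (f 2%N) else 0).
Proof.
move=> le_d1p yE.
(* For i >= 2, p >= d1 gives p i >= 2 d1, so this subtraction is exact; for i >= 3 the exponent is
   positive and h divides phi_i. *)
pose phi i := match i with 0%N => 1 | 1%N => y | _ => h ^+ (p * i - 2 * d1) * f i end.
have phiE i : (i <= 2 * k.+1)%N -> h ^+ (p * i) * f i = h ^+ (2 * d1) * phi i.
  case: i => [|[|i]] _; rewrite /phi; first by rewrite muln0 mul1r mulr1.
    by rewrite muln1.
  by rewrite mulrA -exprD subnKC //; nia.
have [||gam [gam0 gamE rec]] :=
  @leading_bracket (2 * d1) _ _ p a f g phi _ _ f0 g0 bracket0 phiE.
- by lia.
- by lia.
have nzB n : (n%:R == 0 :> B) = (n == 0%N) := proj1 (pcharf0P B) charB n.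
have phi_ge3 i : sigma (phi i.+3) = 0.
  apply: (@dvd_cancelX (2 * d1) (p * i.+3) (f i.+3)); first by nia.
  by rewrite mulrA -exprD subnKC //; nia.
have phi2 : sigma (phi 2%N) = if p == d1 then sigma (f 2%N) else 0.
  rewrite /phi; case: eqP => [->|/eqP ne]; first by rewrite mulnC subnn mul1r.
  rewrite rmorphM rmorphXn /= sigma_h expr0n subn_eq0 leqNgt.
  by rewrite [(_ < _)%N](_ : _ = true) ?mul0r //; nia.
rewrite -phi2; apply: (@euler_defect_eq0 B k.+1 _ _ (sigma \o gam)) => //=.
- by rewrite gam0.
- by apply: (dvd_cancelX _ (gamE _ (leqnn _))); nia.
move=> m le_m; have nz_d1 : d1%:R != 0 :> B by rewrite nzB; lia.
have nz_p : p%:R - 1%:R != 0 :> B by rewrite -natrB ?nzB; lia.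
(* As d = 2 d1 and N = d1 (2 k + 1), the factor d j - N i is d1 (2 j - (2 k + 1) i); i = 0, 1, 2
   give the three coefficients of the defect for K = k + 1. *)
apply: (mulfI nz_d1); rewrite mulr0; apply: (mulfI nz_p); rewrite mulr0.
rewrite -[RHS](rec _ le_m); congr (_ * _); rewrite /euler_defect.
case: m {le_m} => [|[|m]] /=.
- by rewrite big_ord1 /= subnn; ring.
- by rewrite !big_ord_recl big_ord0 /= /bump /= rmorph1 ?addn0 !subn0 ?subnn; ring.
rewrite !big_ord_recl big1 => [|i _]; last first.
  by rewrite [nat_of_ord _](_ : _ = i.+3) // phi_ge3 mulr0 mul0r.
by rewrite /= /bump /= !addn0 rmorph1 !subn0 !subSS ?subn0; ring.
Qed.

Lemma leading_parts : exists2 y, f 1%N = h ^+ d1 * y & sigma y ^+ 2 = 4 * sigma (f 2%N).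
Proof.
(* Descent on p = 2 d1 - e, from the trivial case y = f_1 at p = 2 d1 to p = d1; each step divides y
   by h. *)
suff H e : (e <= d1)%N -> exists y, h ^+ (2 * d1 - e) * f 1%N = h ^+ (2 * d1) * y.
  have [y] := H d1 (leqnn _).
  rewrite [X in h ^+ X * _](_ : _ = d1) => [yE|]; last by lia.
  exists y; last by rewrite (sqr_leading_part (leqnn d1)) ?eqxx // mul2n -addnn.
  by apply: (mulfI (expf_neq0 d1 h_neq0)); rewrite yE mul2n -addnn exprD mulrA.
elim: e => [|e IH] le_e; first by exists (f 1%N); rewrite subn0.
have [|y yE] := IH; first exact: ltnW.
have le_e' : (d1 <= 2 * d1 - e)%N by lia.
have := sqr_leading_part le_e' yE; rewrite ifN; last by lia.
rewrite mulr0 => /eqP; rewrite sqrf_eq0 => /eqP /ker_sigma [z zE]; exists z.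
apply: (mulfI h_neq0); rewrite mulrA -exprS.
rewrite [X in h ^+ X * _](_ : _ = 2 * d1 - e)%N; last by lia.
by rewrite yE zE mulrCA.
Qed.

End Descent.

End LeadingParts.

(** * Homogeneous polynomials: Euler's identity, components and factors *)

Section Homogeneous.

Variables (n : nat) (R : idomainType).
Implicit Types (p q : {mpoly R[n]}) (l : 'I_n).

Lemma dhomog_mderiv e p l : p \is e.-homog -> p^`M(l) \is (e.-1).-homog.
Proof.
move=> /dhomogP hp; apply/dhomogP => m; rewrite mcoeff_msupp mcoeff_mderiv => nz.
have /hp /= <- : (m + U_(l))%MM \in msupp p.
  by rewrite mcoeff_msupp; apply: contraNneq nz => ->; rewrite mul0rn.
by rewrite /= mdegD mdeg1 addn1.
Qed.

Lemma euler_dhomog e p : p \is e.-homog -> \sum_(l < n) 'X_l * p^`M(l) = e%:R * p.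
Proof.
move=> /dhomogP hp; rewrite (mpolyE p) mulr_sumr.
under eq_bigr do rewrite raddf_sum mulr_sumr.
rewrite exchange_big /= big_seq [RHS]big_seq; apply: eq_bigr => m /hp /= mE.
transitivity (\sum_(l < n) (m l)%:R * (p@_m *: 'X_[m])).
  apply: eq_bigr => l _; rewrite mderivZ mderivX.
  case: (posnP (m l)) => [->|ml]; first by rewrite scale0r scaler0 mulr0 mul0r.
  have e_m : m = (m - U_(l) + U_(l))%MM.
    by rewrite submK //; apply/mnm_lepP => i; rewrite mnm1E; case: eqP => // <-.
  rewrite [X in _ = _ * (_ *: 'X_[X])]e_m mpolyXD -!mul_mpolyC mpolyC_nat; ring.
by rewrite -mulr_suml -natr_sum -mdegE mE.
Qed.

Lemma dhomog0_const p : p \is 0.-homog -> p = (p@_0)%:MP.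
Proof.
move=> /dhomogP hp; apply: msize1_polyC; rewrite msizeE.
by apply/bigmax_leqP_seq => m /hp /= ->.
Qed.

Lemma pihomog_dhomogM e j p q : p \is e.-homog ->
  pihomog mdeg (e + j) (p * q) = p * pihomog mdeg j q.
Proof.
move=> hp; elim/mpolyind: q => [|c m q _ _ IH]; first by rewrite mulr0 !raddf0 mulr0.
rewrite mulrDr !raddfD /= IH mulrDr; congr (_ + _).
rewrite -scalerAr !linearZ /= -scalerAr; congr (_ *: _); rewrite pihomogX.
have hm : p * 'X_[m] \is (e + mdeg m).-homog by apply: dhomogM => //; rewrite dhomogX.
case: eqP => [<-|/eqP ne]; first by rewrite pihomog_dE.
by rewrite mulr0 (pihomog_ne0 _ hm) // eqn_add2l.
Qed.

(** The component of degree e + j of p q is p times the component of degree j of q, and p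
    cancels. *)
Lemma dhomog_mulIl e j p q : p != 0 -> p \is e.-homog -> p * q \is (e + j).-homog ->
  q \is j.-homog.
Proof.
move=> p0 hp hpq; rewrite homog_piE; apply/eqP/(mulfI p0).
by rewrite -(pihomog_dhomogM _ _ hp) pihomog_dE.
Qed.

Lemma pihomog_ge_msize e p : (msize p <= e)%N -> pihomog mdeg e p = 0.
Proof.
move=> le_pe; rewrite pihomogE big_seq_cond big_pred0 // => m.
by apply/andP => -[/msize_mdeg_lt lt /eqP /= mE]; lia.
Qed.

Lemma pchar_mpoly : [pchar R] =i pred0 -> [pchar {mpoly R[n]}] =i pred0.
Proof.
move=> /pcharf0P ch; apply/pcharf0P => m.
by rewrite -mpolyC_nat mpolyC_eq0 ch.
Qed.

End Homogeneous.

(** * Reduction modulo a linear form *)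

Section LinearForm.

Variables (n : nat) (K : fieldType) (h : {mpoly K[n]}).
Hypotheses (h_homog : h \is 1.-homog) (h_neq0 : h != 0).

Lemma mderiv_linear_form l : h^`M(l) = (h@_U_(l))%:MP.
Proof.
rewrite (dhomog0_const (dhomog_mderiv l h_homog)) mcoeff_mderiv.
by rewrite add0m mnm0E mulr1n.
Qed.

Lemma linear_form_pivot : exists l, h@_U_(l) != 0.
Proof.
have [m hm] : exists m, m \in msupp h.
  have : msupp h != [::] by rewrite msupp_eq0.
  by case: (msupp h) => // m s _; exists m; rewrite mem_head.
have /eqP/mdeg1P[l /eqP e_m] := dhomog_mf h_homog hm.
by exists l; rewrite -mcoeff_msupp -e_m.
Qed.

Variable l : 'I_n.
Hypothesis pivot : h@_U_(l) != 0.

Let c := h@_U_(l).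

(* Setting h = 0 by solving for the variable of index l; its kernel is (h). *)
Definition eliminate : {mpoly K[n]} -> {mpoly K[n]} :=
  comp_mpoly [tuple 'X_i - ((i == l)%:R / c) *: h | i < n].

HB.instance Definition _ := GRing.RMorphism.copy eliminate eliminate.

(** Only the variable of index l changes, by h / c, and its coefficient in h is c, so h goes to h -
    h. *)
Lemma eliminate_linear_form : eliminate h = 0.
Proof.
have hE : h = \sum_i h@_U_(i) *: 'X_i.
  rewrite -[LHS]mul1r -[1]/(1%:R) -(euler_dhomog h_homog); apply: eq_bigr => i _.
  by rewrite mderiv_linear_form mulrC mul_mpolyC.
rewrite [in eliminate h]hE raddf_sum /=.
under eq_bigr do rewrite /eliminate linearZ /= comp_mpolyXU -tnth_nth tnth_mktuple scalerBr scalerA.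
rewrite sumrB -hE -scaler_suml (bigD1 l) //= big1 => [|i /negPf ->].
  by rewrite eqxx addr0 mul1r divff // scale1r subrr.
by rewrite mul0r mulr0.
Qed.

(** Modulo h every f is congruent to [eliminate f]: this holds for variables and passes to products
    and sums. *)
Lemma eliminate_eq0 f : eliminate f = 0 -> exists g, f = h * g.
Proof.
suff [g e] : exists g, f - eliminate f = h * g by move=> f0; exists g; rewrite -e f0 subr0.
elim/mpolyind: f => [|b m f _ _ [g IH]]; first by exists 0; rewrite raddf0 subr0 mulr0.
suff [g' e] : exists g', 'X_[m] - eliminate 'X_[m] = h * g'.
  exists (b *: g' + g); rewrite raddfD /= /eliminate linearZ /= opprD addrACA.
  by rewrite -/eliminate IH -scalerBr e mulrDr scalerAr.
rewrite mpolyXE_id; elim/big_rec: _ => [|i q _ [g1 e1]].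
  by exists 0; rewrite rmorph1 subrr mulr0.
suff [g2 e2] : exists g2, 'X_i ^+ m i - eliminate ('X_i ^+ m i) = h * g2.
  exists (g2 * q + eliminate ('X_i ^+ m i) * g1); rewrite rmorphM.
  by rewrite mulrDr mulrA -e2 mulrCA -e1; ring.
elim: (m i) => [|e [g2 IH2]]; first by exists 0; rewrite !expr0 rmorph1 subrr mulr0.
exists (((i == l)%:R / c) *: 'X_i ^+ e + eliminate 'X_i * g2).
rewrite exprS rmorphM /= mulrDr mulrCA -IH2 -scalerAr.
have -> : eliminate 'X_i = 'X_i - ((i == l)%:R / c) *: h.
  by rewrite /eliminate comp_mpolyXU -tnth_nth tnth_mktuple.
by rewrite -!mul_mpolyC; ring.
Qed.

End LinearForm.

(** * Graded components of the Poisson bracket *)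

Section BracketComponents.

Variables (n : nat) (R : idomainType) (d N M : nat) (f g : nat -> {mpoly R[n]}).
Hypotheses (f_homog : forall i, (i < d)%N -> f i \is (d - i).-homog)
  (f_ge : forall i, (d <= i)%N -> f i = 0).
Hypotheses (g_homog : forall j, (j < N)%N -> g j \is (N - j).-homog)
  (g_ge : forall j, (N <= j)%N -> g j = 0).

Let F := \sum_(i < d) f i.
Let G := \sum_(j < N) g j.

(** The sum is the component of degree d + N - 2 - m of one coefficient of [F, G], and that degree
    exceeds the degree of the coefficient. *)
Lemma bracket_component (a b : 'I_n) m :
  (msize (F^`M(a) * G^`M(b) - F^`M(b) * G^`M(a)) <= d + N - 2 - m)%N ->
  (m + 2 <= d + N)%N ->
  \sum_(i < m.+1) ((f i)^`M(a) * (g (m - i)%N)^`M(b)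
                   - (f i)^`M(b) * (g (m - i)%N)^`M(a)) = 0.
Proof.
move=> w_small le_m.
pose X i j := (f i)^`M(a) * (g j)^`M(b) - (f i)^`M(b) * (g j)^`M(a).
have Xf i j : (d <= i)%N -> X i j = 0.
  by move=> le_di; rewrite /X f_ge // !raddf0 !mul0r subrr.
have Xg i j : (N <= j)%N -> X i j = 0.
  by move=> le_Nj; rewrite /X g_ge // !raddf0 !mulr0 subrr.
have Xhom i j : (i < d)%N -> (j < N)%N -> X i j \is (d + N - 2 - (i + j)).-homog.
  move=> lt_id lt_jN.
  have -> : (d + N - 2 - (i + j) = (d - i).-1 + (N - j).-1)%N by lia.
  by apply: rpredB; apply: dhomogM; apply: dhomog_mderiv; auto.
have FGE : F^`M(a) * G^`M(b) - F^`M(b) * G^`M(a) = \sum_(i < d) \sum_(j < N) X i j.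
  have mderiv_sum D (u : nat -> {mpoly R[n]}) (c : 'I_n) :
    (\sum_(i < D) u i)^`M(c) = \sum_(i < D) (u i)^`M(c) by rewrite raddf_sum.
  rewrite /F /G !mderiv_sum !mulr_suml -sumrB; apply: eq_bigr => i _.
  by rewrite !mulr_sumr -sumrB.
transitivity (pihomog mdeg (d + N - 2 - m)
                (F^`M(a) * G^`M(b) - F^`M(b) * G^`M(a))); last exact: pihomog_ge_msize.
rewrite FGE raddf_sum /=.
transitivity (\sum_(i < d) (if (i < m.+1)%N then X i (m - i)%N else 0)).
  rewrite -[RHS]big_mkcond /=.
  rewrite [LHS](big_ord_widen_cond (maxn d m.+1) predT (fun i => X i (m - i)%N)) ?leq_maxr //.
  rewrite [RHS](big_ord_widen_cond (maxn d m.+1) (fun i => i < m.+1)%N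
             (fun i => X i (m - i)%N)) ?leq_maxl //.
  rewrite [LHS]big_mkcond [RHS]big_mkcond; apply: eq_bigr => i _ /=.
  by case: (ltnP i d) => [_|le_di]; rewrite ?andbT // andbF Xf ?if_same.
apply: eq_bigr => i _; rewrite raddf_sum /=.
transitivity (\sum_(j < N | (i + j == m)%N) X i j).
  case: ltnP => [le_im|lt_mi]; last by rewrite big_pred0 // => j; lia.
  rewrite (eq_bigl (fun j : 'I_N => j == m - i :> nat)%N) => [|j]; last by lia.
  by rewrite (big_ord1_eq _ (X i)); case: ltnP => // /Xg ->.
rewrite big_mkcond; apply: eq_bigr => j _.
have Xij := Xhom _ _ (ltn_ord i) (ltn_ord j).
case: eqP => [<-|ne]; first by rewrite pihomog_dE.
(* The bounds on i, j and m keep the natural subtractions exact, so i + j <> m means a different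
   degree. *)
by rewrite (pihomog_ne0 _ Xij) //; have := ltn_ord i; have := ltn_ord j; lia.
Qed.

(** Multiply the (l, b) coefficient by X_b and sum over b; Euler's identity turns the derivatives in
    direction b into degrees. *)
Lemma bracket_euler (l : 'I_n) m :
  (forall a b : 'I_n, (a < b)%N ->
    \sum_(i < m.+1) ((f i)^`M(a) * (g (m - i)%N)^`M(b)
                   - (f i)^`M(b) * (g (m - i)%N)^`M(a)) = 0) ->
  \sum_(i < m.+1) ((N%:R - (m - i)%:R) * (f i)^`M(l) * g (m - i)%N
                   - (d%:R - i%:R) * f i * (g (m - i)%N)^`M(l)) = 0.
Proof.
move=> br0.
have ef i : \sum_b 'X_b * (f i)^`M(b) = (d%:R - i%:R) * f i.
  have [le_di|lt_id] := leqP d i; last by rewrite (euler_dhomog (f_homog lt_id)) natrB 1?ltnW.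
  by rewrite f_ge // mulr0 big1 // => b _; rewrite raddf0 mulr0.
have eg j : \sum_b 'X_b * (g j)^`M(b) = (N%:R - j%:R) * g j.
  have [le_Nj|lt_jN] := leqP N j; last by rewrite (euler_dhomog (g_homog lt_jN)) natrB 1?ltnW.
  by rewrite g_ge // mulr0 big1 // => b _; rewrite raddf0 mulr0.
transitivity (\sum_b 'X_b * \sum_(i < m.+1) ((f i)^`M(l) * (g (m - i)%N)^`M(b)
                   - (f i)^`M(b) * (g (m - i)%N)^`M(l))).
  under [RHS]eq_bigr do rewrite mulr_sumr.
  rewrite exchange_big /=; apply: eq_bigr => i _.
  rewrite [X in X - _]mulrAC -eg -ef !mulr_suml -sumrB.
  by apply: eq_bigr => b _; ring.
(* The hypothesis covers l < b; antisymmetry gives b < l, and for b = l the terms cancel. *)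
apply: big1 => b _; case: (ltngtP l b) => [lt_lb|lt_bl|/val_inj ->].
- by rewrite br0 ?mulr0.
- rewrite -[X in _ * X]opprK -sumrN; under eq_bigr do rewrite opprB.
  by rewrite br0 // oppr0 mulr0.
- by rewrite big1 ?mulr0 // => i _; rewrite subrr.
Qed.

End BracketComponents.

(** The symbol accounts for 2, and [msize] is one more than the degree of a nonzero polynomial. *)
Lemma msize_pbracket (R : nzRingType) n (f g : {mpoly R[n]}) (a b : 'I_n) (e : nat) :
  (bdeg (pbracket f g) < (e.+2%:Z)%:E)%E -> (a < b)%N ->
  (msize (f^`M(a) * g^`M(b) - f^`M(b) * g^`M(a)) <= e)%N.
Proof.
move=> lt_e lt_ab; set w := _ - _.
have wE : pbracket f g a b = w by rewrite mxE lt_ab.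
have le_w : (2%:E + tdeg w <= bdeg (pbracket f g))%E.
  rewrite -wE; apply: leeD2l.
  exact: (le_bigmax_cond -oo%E (fun ij => tdeg (pbracket f g ij.1 ij.2)) (j := (a, b))).
have := le_lt_trans le_w lt_e; rewrite /tdeg.
case: eqP => [->|/eqP w0]; first by rewrite msize0.
rewrite -EFinD lte_fin; have : (0 < msize w)%N by rewrite lt0n msize_poly_eq0.
lia.
Qed.

(** * Application to complex polynomials *)

Theorem theorem6p5 (R : realType) (n d1 k d s N : nat)
  (hd1 : (2 <= d1)%N) (hk : (1 <= k)%N)
  (hd : d = (2 * d1)%N) (hs : s = (d - 1)%N)
  (hN : N = (2 * d1 * k + d1)%N)
  (F G h : {mpoly R[i][n]}) (F_ G_ : nat -> {mpoly R[i][n]}) (aN : R[i])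
  (hF_ : forall i : nat, (1 <= i <= d)%N -> F_ i \is i.-homog)
  (hG_ : forall j : nat, (1 <= j <= N)%N -> G_ j \is j.-homog)
  (hF : F = \sum_(1 <= i < s.+1) F_ i + F_ d)
  (hG : G = \sum_(1 <= j < N.+1) G_ j)
  (hFG : (bdeg (pbracket F G) < (d%:Z + N%:Z - 2 * k%:Z - 2)%:E)%E)
  (hh : h \is 1.-homog) (hh0 : h != 0) (haN : aN != 0)
  (hFd : F_ d = h ^+ d) (hGN : G_ N = aN *: h ^+ N) :
  exists Ftilde Fhat : {mpoly R[i][n]},
    [/\ Ftilde \is (d1 - 1)%N.-homog,
        F_ s = h ^+ d1 * Ftilde,
        Fhat \is (s - 2)%N.-homog
      & F_ (s - 1)%N = (4%:R^-1 : R[i]) *: (Ftilde ^+ 2 + h * Fhat)].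
Proof.
have charK : [pchar R[i]] =i pred0 by apply/pcharf0P => m; rewrite pnatr_eq0.
have scale4K (p : {mpoly R[i][n]}) : (4%:R^-1 : R[i]) *: (4 * p) = p.
  by rewrite -mpolyC_nat mul_mpolyC scalerA mulVf ?scale1r // pnatr_eq0.
have {}hN : N = (d1 * (2 * k).+1)%N by lia.
(* Components are indexed downwards from the top degree; the value 0 at the end reflects that F and
   G have no constant term. *)
pose f i := if (i < d)%N then F_ (d - i)%N else 0.
pose g j := if (j < N)%N then G_ (N - j)%N else 0.
have d_gt2 : (2 < d)%N by lia.
have f1 : f 1%N = F_ s by rewrite /f (ltnW d_gt2) hs.
have f2 : f 2%N = F_ (s - 1)%N by rewrite /f d_gt2 hs -subnDA.
have f_homog i : (i < d)%N -> f i \is (d - i).-homog.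
  by move=> lt_id; rewrite /f lt_id hF_ //; lia.
have f_ge i : (d <= i)%N -> f i = 0 by move=> le_di; rewrite /f ltnNge le_di.
have g_homog j : (j < N)%N -> g j \is (N - j).-homog.
  by move=> lt_jN; rewrite /g lt_jN hG_ //; lia.
have g_ge j : (N <= j)%N -> g j = 0 by move=> le_Nj; rewrite /g ltnNge le_Nj.
have rev e (P : nat -> {mpoly R[i][n]}) :
    \sum_(1 <= i < e.+1) P i = \sum_(i < e) (if (i < e)%N then P (e - i)%N else 0).
  rewrite big_nat_rev big_add1 big_mkord; apply: eq_bigr => i _.
  by rewrite ltn_ord; congr P; lia.
have FE : F = \sum_(i < d) f i.
  have ds : d = s.+1 by lia.
  by rewrite hF -[RHS](rev d F_) ds [RHS]big_nat_recr.
have GE : G = \sum_(j < N) g j by rewrite hG rev.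
have [l pivot] := linear_form_pivot hh hh0.
pose c := h@_U_(l); pose D p := c^-1 *: p^`M(l).
have DM p q : D (p * q) = D p * q + p * D q.
  by rewrite /D mderivM scalerDr scalerAl scalerAr.
have Dh : D h = 1.
  by rewrite /D (mderiv_linear_form hh) -mul_mpolyC -mpolyCM mulVf.
have bracket0 m : (m <= 2 * k.+1)%N ->
  \sum_(i < m.+1) (((d1 * (2 * k).+1)%:R - (m - i)%:R) * D (f i) * g (m - i)%N
                   - ((2 * d1)%:R - i%:R) * f i * D (g (m - i)%N)) = 0.
  move=> le_m; have br0 (a b : 'I_n) : (a < b)%N -> \sum_(i < m.+1)
      ((f i)^`M(a) * (g (m - i)%N)^`M(b) - (f i)^`M(b) * (g (m - i)%N)^`M(a)) = 0.
    move=> lt_ab; apply: (bracket_component f_homog f_ge g_homog g_ge); last by nia.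
    (* The bracket degree is below e + 2 for e = d + N - 2 - 2 (k + 1), the least of the degrees d +
       N - 2 - m. *)
    rewrite -FE -GE; apply: leq_trans (_ : d + N - 2 - 2 * k.+1 <= _)%N; last by lia.
    apply: msize_pbracket lt_ab.
    rewrite [X in (_ < X%:E)%E](_ : _ = d%:Z + N%:Z - 2 * k%:Z - 2) //; nia.
  have /(congr1 ( *:%R c^-1)) := bracket_euler f_homog f_ge g_homog g_ge l br0.
  rewrite scaler0 scaler_sumr => e; rewrite -[RHS]e; apply: eq_bigr => i _.
  by rewrite /D -!mul_mpolyC hd hN; ring.
have f0 : f 0%N = h ^+ (2 * d1).
  have d_gt0 : (0 < d)%N by lia.
  by rewrite /f d_gt0 subn0 hFd hd.
have g0 : g 0%N = h ^+ (d1 * (2 * k).+1) * aN%:MP.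
  have N_gt0 : (0 < N)%N by lia.
  by rewrite /g N_gt0 subn0 hGN -hN -mul_mpolyC mulrC.
have aN0 : eliminate h l aN%:MP != 0 by rewrite /eliminate comp_mpolyC mpolyC_eq0.
have [y f1E sq] := leading_parts (pchar_mpoly n charK) DM Dh hh0
  (eliminate_linear_form hh pivot) (@eliminate_eq0 _ _ h l) hd1 aN0 f0 g0 bracket0.
(* [y] is [Ftilde]; since y^2 = 4 f_2 once h is set to 0, the quotient [z] serves as [Fhat]. *)
have [z zE] : exists z, 4 * f 2%N - y ^+ 2 = h * z.
  apply: (@eliminate_eq0 _ _ h l).
  by rewrite rmorphB rmorphM rmorphXn rmorph_nat /= sq subrr.
have y_homog : y \is (d1 - 1).-homog.
  have hhX : h ^+ d1 \is d1.-homog by have := dhomogMn d1 hh; rewrite mul1n.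
  apply: (dhomog_mulIl (expf_neq0 d1 hh0) hhX).
  rewrite -f1E [X in X.-homog](_ : _ = d - 1)%N; last by lia.
  by apply: f_homog; lia.
have z_homog : z \is (s - 2).-homog.
  have [e1 e2] : (1 + (s - 2) = d - 2 /\ (d1 - 1) * 2 = d - 2)%N by lia.
  apply: (dhomog_mulIl hh0 hh); rewrite -zE e1; apply: rpredB.
    by rewrite mulr_natl; apply/rpredMn/f_homog.
  by rewrite -e2; apply: dhomogMn.
exists y, z; split; [exact: y_homog | by rewrite -f1 | exact: z_homog |].
rewrite -zE addrC subrK -f2; exact/esym/scale4K.
Qed.
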